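(* Let $K$ be an algebraic extension of $\mathbb{Q}$ and let $F_1,F_2$ be finite extensions of $K$. Suppose $F_1$ and $F_2$ are entangleable by a field $L/K$. If either (i) $F_1$ and $F_2$ are both Galois over $K$, or (ii) $L$ is Galois over $K$, then $F_1$ and $F_2$ are entangleable by $L_0:=L\cap F_1F_2$, and $\operatorname{Gal}(L_0F_i/L_0)\cong\operatorname{Gal}(LF_i/L)$ for $i=1,2$.
   Context: All fields lie in a fixed algebraic closure of $K$. Finite extensions $F_1,F_2$ of $K$ are said to be entangleable by an extension $L/K$ if $LF_1=LF_2\supsetneq L$ (composita taken in the fixed algebraic closure).
   Formalization: In case (ii) Gal(L_0F_i/L_0) ≅ Gal(LF_i/L) is claimed only when L_0F_i/L_0 is Galois (it fails for K=Q, F_1=F_2=Q(∛2), L=Q(ω)); otherwise a bijection between L_0-embeddings of L_0F_i and L-embeddings of LF_i is shown. *)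

(* Defs.v *)
From HB Require Import structures.
From mathcomp Require Import all_boot all_order all_algebra.
From mathcomp Require Import separable boolp.

Set Implicit Arguments.
Unset Strict Implicit.
Unset Printing Implicit Defensive.

Import GRing.Theory.
Local Open Scope ring_scope.

(* A subfield of the ambient field C is a divringClosed C, i.e. a predicate
   containing 1 and closed under subtraction and division (x / 0 = 0).  With
   the classical axioms of boolp, boolean predicates are arbitrary subsets, so
   infinite extensions are covered. *)
Definition subfield_type (C : fieldType) (E : divringClosed C) : Type :=
  {x : C | x \in E}.

Section SubfieldType.
Variables (C : fieldType) (E : divringClosed C).
HB.instance Definition _ := SubChoice.on (subfield_type E).
HB.instance Definition _ := [SubChoice_isSubIntegralDomain of subfield_type E by <:].
HB.instance Definition _ := [SubIntegralDomain_isSubField of subfield_type E by <:].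
End SubfieldType.

Section Lattice.
Variable C : fieldType.
Implicit Types E F : divringClosed C.

Definition capf E F : {pred C} := [pred x | (x \in E) && (x \in F)].

Lemma capf_closed E F : divring_closed (capf E F).
Proof.
split=> [|x y|x y]; rewrite !inE ?rpred1 //.
  by move=> /andP[? ?] /andP[? ?]; rewrite !rpredB.
by move=> /andP[? ?] /andP[? ?]; rewrite !rpred_div.
Qed.

HB.instance Definition _ E F :=
  GRing.isDivringClosed.Build C (capf E F) (capf_closed E F).

Definition compositum E F : {pred C} :=
  [pred x | `[< forall S : divringClosed C,
                  {subset E <= S} -> {subset F <= S} -> x \in S >]].

Lemma compositum_closed E F : divring_closed (compositum E F).
Proof.
split=> [|x y|x y]; rewrite !inE.
- by apply/asboolP=> S _ _; rewrite rpred1.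
- move=> /asboolP Ex /asboolP Ey; apply/asboolP=> S ES FS.
  by rewrite rpredB ?Ex ?Ey.
- move=> /asboolP Ex /asboolP Ey; apply/asboolP=> S ES FS.
  by rewrite rpred_div ?Ex ?Ey.
Qed.

HB.instance Definition _ E F :=
  GRing.isDivringClosed.Build C (compositum E F) (compositum_closed E F).

End Lattice.

Section Extensions.
Variable C : fieldType.
Implicit Types (K E F L : divringClosed C) (x : C) (p : {poly C}).

Definition algebraic_over K x :=
  exists p, [/\ p \is a polyOver K, p != 0 & root p x].

Definition finite_ext K F :=
  {subset K <= F} /\
  exists s : seq C, {subset s <= F} /\
    forall x, x \in F ->
      exists a : nat -> C, (forall i, a i \in K) /\
        x = \sum_(i < size s) a i * s`_i.

Definition min_poly K x p :=
  [/\ p \is a polyOver K, p \is monic, root p x &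
      forall q, q \is a polyOver K -> q != 0 -> root q x ->
        (size p <= size q)%N].

(* Algebraic, separable and normal, of possibly infinite degree. *)
Definition galois_ext K E :=
  {subset K <= E} /\
  forall x, x \in E ->
    algebraic_over K x /\
    forall p, min_poly K x p ->
      separable_poly p /\
      exists rs : seq C, {subset rs <= E} /\ p = \prod_(r <- rs) ('X - r%:P).

Definition entangleable_by K F1 F2 L :=
  [/\ {subset K <= L},
      compositum L F1 =i compositum L F2,
      {subset L <= compositum L F1} &
      ~ {subset compositum L F1 <= L}].

End Extensions.

Section Gal.
Variables (C : fieldType) (F E : divringClosed C).
Local Notation eE := (subfield_type E).

Definition is_gal (f : eE -> eE) :=
  [/\ zmod_morphism f, monoid_morphism f, bijective f &
      forall x : eE, val x \in F -> f x = x].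

Definition gal : Type := {f : eE -> eE | `[< is_gal f >]}.
HB.instance Definition _ := SubChoice.on gal.

Definition gal_fun (s : gal) : eE -> eE := val s.

Lemma is_gal1 : `[< is_gal id >].
Proof. by apply/asboolP; split=> //; exists id. Qed.

Lemma is_galM (s t : gal) : `[< is_gal (gal_fun s \o gal_fun t) >].
Proof.
have /asboolP[sB [s1 sM] sb sF] := valP s.
have /asboolP[tB [t1 tM] tb tF] := valP t.
apply/asboolP; split; last by move=> x Fx; rewrite /= /gal_fun tF ?sF.
- by move=> x y; rewrite /= /gal_fun tB sB.
- by split=> [|x y]; rewrite /= /gal_fun ?t1 ?s1 ?tM ?sM.
- exact: bij_comp.
Qed.

Lemma is_galV (s : gal) :
  exists t : gal, cancel (gal_fun s) (gal_fun t) /\ cancel (gal_fun t) (gal_fun s).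
Proof.
case: s => [s /= ss]; have /asboolP[sB [s1 sM] [t st ts] sF] := ss.
have tP : `[< is_gal t >].
  apply/asboolP; split; last by move=> x Fx; rewrite -{1}(sF x Fx) st.
  - by move=> x y; apply: (can_inj st); rewrite sB !ts.
  - by split=> [|x y]; apply: (can_inj st); rewrite ?sM !ts ?s1.
  - by exists s.
by exists (exist _ t tP).
Qed.

Definition gal1 : gal := Sub id is_gal1.
Definition galM (s t : gal) : gal := Sub (gal_fun s \o gal_fun t) (is_galM s t).
Definition galV (s : gal) : gal := projT1 (cid (is_galV s)).

Lemma galMA : associative galM.
Proof. by move=> s t u; apply: val_inj. Qed.
Lemma gal1M : left_id gal1 galM.
Proof. by move=> s; apply: val_inj. Qed.
Lemma galM1 : right_id gal1 galM.
Proof. by move=> s; apply: val_inj. Qed.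
Lemma galVM : left_inverse gal1 galV galM.
Proof.
move=> s; apply: val_inj; apply: funext => x.
by rewrite /= /galV; case: cid => t [/= st _]; apply: st.
Qed.
Lemma galMV : right_inverse gal1 galV galM.
Proof.
move=> s; apply: val_inj; apply: funext => x.
by rewrite /= /galV; case: cid => t [/= _ ts]; apply: ts.
Qed.

HB.instance Definition _ := isGroup.Build gal galMA gal1M galM1 galVM galMV.

(* The F-embeddings of E into C.  When C is algebraically closed and E/F is
   Galois they are exactly the elements of gal F E; they replace it when E/F is
   not Galois and gal F E may be too small (e.g. trivial for Q(2^(1/3))/Q). *)
Definition embedding : Type :=
  {f : eE -> C | `[< [/\ zmod_morphism f, monoid_morphism f &
                         forall x : eE, val x \in F -> f x = val x] >]}.

End Gal.

Definition group_isomorphic (G H : groupType) :=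
  exists f : {multiplicative G -> H}, bijective f.

(* Main.v *)
Require Import Defs.
From HB Require Import structures.
From mathcomp Require Import all_boot all_order all_algebra.
From mathcomp Require Import separable boolp.

Set Implicit Arguments.
Unset Strict Implicit.
Unset Printing Implicit Defensive.

Import GRing.Theory.
Local Open Scope ring_scope.

(** Put M = F1 F2 and L0 = L \cap M.  In case (i) M is normal over K, in case
    (ii) L is.  If N is normal over K and A is any field containing K, the
    minimal polynomial over A of an element of N has its roots in N, hence its
    coefficients in N \cap A.  With primitive elements this shows that L and M
    are linearly disjoint over L0.  Consequently an element of M lying in L(x),
    for x in M, already lies in L0(x), which gives L0 F1 = L0 F2; and a
    generator x of L0 Fi over L0 has the same minimal polynomial over L0 and
    over L, so every homomorphism of L0(x) over L0 extends uniquely to L(x)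
    over L. *)

(** * Minimal polynomials and simple extensions inside an ambient field *)

Section PolyOverSubfield.
Variable C : fieldType.
Implicit Types (k E : divringClosed C) (p q r : {poly C}) (x y : C).

(** Bridge to polynomials over the field type [subfield_type k], where division and the primitive
    element theorem of the library apply. *)
Lemma polyOver_subfieldP k p :
  reflect (exists p' : {poly subfield_type k}, p = map_poly val p')
          (p \is a polyOver k).
Proof.
apply: (iffP polyOverP) => [kp | [p' -> i]]; last by rewrite coef_map;
  apply: valP.
exists (\poly_(i < size p) insubd (0 : subfield_type k) p`_i).
apply/polyP=> i; rewrite coef_map coef_poly; case: ltnP => [_|?].
  by rewrite /= insubdK.
by rewrite nth_default.
Qed.

Lemma polyOver_sub k E p :
  {subset k <= E} -> p \is a polyOver k -> p \is a polyOver E.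
Proof. by move=> kE /polyOverP kp; apply/polyOverP=> i; apply: kE. Qed.

Lemma algebraic_over_sub k E x :
  {subset k <= E} -> algebraic_over k x -> algebraic_over E x.
Proof. by move=> kE [p [kp p0 px]]; exists p; split=> //;
  apply: polyOver_sub kp. Qed.

Lemma modp_over k p q :
  p \is a polyOver k -> q \is a polyOver k -> p %% q \is a polyOver k.
Proof.
move=> /polyOver_subfieldP[p' ->] /polyOver_subfieldP[q' ->].
by rewrite -map_modp; apply/polyOver_subfieldP; exists (p' %% q').
Qed.

Lemma divp_over k p q :
  p \is a polyOver k -> q \is a polyOver k -> p %/ q \is a polyOver k.
Proof.
move=> /polyOver_subfieldP[p' ->] /polyOver_subfieldP[q' ->].
by rewrite -map_divp; apply/polyOver_subfieldP; exists (p' %/ q').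
Qed.

Lemma min_poly_exists k x : algebraic_over k x -> exists p, min_poly k x p.
Proof.
move=> [p0 [kp0 p0n0 p0x]].
pose P n := `[< exists p, [/\ p \is a polyOver k, p != 0, root p x &
  size p = n] >].
have exP : exists n, P n by exists (size p0); apply/asboolP; exists p0.
case: (ex_minnP exP) => n /asboolP[p [kp pn0 px pn]] minn.
exists ((lead_coef p)^-1 *: p);
  have lp0 : lead_coef p != 0 by rewrite lead_coef_eq0.
split.
- by rewrite polyOverZ // rpredV; move/polyOverP: kp; apply.
- by rewrite monicE lead_coefZ mulVf.
- by rewrite rootZ // invr_eq0.
- move=> q kq qn0 qx; rewrite size_scale ?invr_eq0 // pn minn //.
  by apply/asboolP; exists q.
Qed.

Lemma min_poly_dvd k x p r :
  min_poly k x p -> r \is a polyOver k -> root r x -> p %| r.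
Proof.
move=> [kp pm px pmin] kr rx; apply: contraT => npr.
have := pmin (r %% p) (modp_over kr kp) npr.
rewrite leqNgt ltn_modp monic_neq0 //; apply.
have := congr1 (horner^~ x) (divp_eq r p);
  rewrite !hornerE (rootP px) (rootP rx).
by rewrite mulr0 add0r => /esym/rootP.
Qed.

(** The minimal polynomial [q] of [y] divides [p]. The cofactor is smaller than [p], so [x] is a
    root of [q], and minimality of [p] gives [size p <= size q]. *)
Lemma min_poly_conj k x y p : algebraic_over k y ->
  min_poly k x p -> root p y -> min_poly k y p.
Proof.
move=> algy minp py; have [kp pm px pmin] := minp.
have [q minq] := min_poly_exists algy; have [kq qm qy qmin] := minq.
have ks := divp_over kp kq; have Dp := divpK (min_poly_dvd minq kp py).
split=> // r kr rn0 ry; suff pq : (size p <= size q)%N.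
  exact: leq_trans pq (qmin _ kr rn0 ry).
have := monic_neq0 pm; rewrite -{1}Dp mulf_eq0 negb_or => /andP[sn0 qn0].
move: px; rewrite -{1}Dp rootM => /orP[sx|qx]; last exact: pmin.
have := pmin _ ks sn0 sx; rewrite -{1}Dp size_mul //.
have := root_size_gt1 qn0 qy; case: (size q) => [|[|n]] // _.
by rewrite !addnS /= ltnNge leq_addr.
Qed.

(** Write the minimal polynomial as [d * 'X + c]. For [y != 0] minimality gives [c != 0], and [y^-1
    = - c^-1 * d.[y]]; for [y = 0] the convention [0^-1 = 0] applies. *)
Lemma horner_inv k y : algebraic_over k y ->
  exists2 r, r \is a polyOver k & y^-1 = r.[y].
Proof.
move=> algy; have [->|y0] := eqVneq y 0.
  by exists 0; rewrite ?rpred0 // invr0 horner0.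
have [p [kp pm /rootP py pmin]] := min_poly_exists algy.
have [d [c [kd kc Dp]]] : exists d c,
    [/\ d \is a polyOver k, c \in k & p = d * 'X + c%:P].
  have kX : 'X \is a polyOver k by rewrite polyOverX.
  exists (p %/ 'X), (p %% 'X)`_0; split; first exact: divp_over.
    by have /polyOverP := modp_over kp kX; apply.
  rewrite -size1_polyC -?divp_eq //.
  by have := ltn_modp p ('X : {poly C}); rewrite polyX_eq0 size_polyX.
have dn0 : d != 0.
  apply: contraTneq (monic_neq0 pm) => d0; move: py.
  by rewrite Dp d0 mul0r add0r hornerC => ->; rewrite eqxx.
have c0 : c != 0.
  apply/eqP=> c0; move: py; rewrite Dp c0 addr0 hornerM hornerX => /eqP.
  rewrite mulf_eq0 (negPf y0) orbF => dy; have := pmin _ kd dn0 dy.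
  by rewrite Dp c0 addr0 size_mulX // ltnn.
exists ((- c^-1) *: d); first by rewrite polyOverZ // rpredN rpredV.
apply: (mulIf y0); rewrite mulVf // hornerZ -mulrA.
have := py; rewrite Dp hornerD hornerM hornerX hornerC => /eqP;
  rewrite addr_eq0.
by move/eqP->; rewrite mulrNN mulVf.
Qed.

(** The field [k(s)] as an intersection, encoded like [compositum], so that inclusions out of it are
    checked on [k] and [s] only. *)
Definition adjoin k (s : seq C) : {pred C} :=
  [pred x | `[< forall S : divringClosed C,
                  {subset k <= S} -> {subset s <= S} -> x \in S >]].

Lemma adjoin_closed k s : divring_closed (adjoin k s).
Proof.
split=> [|x y|x y]; rewrite !inE.
- by apply/asboolP=> S _ _; rewrite rpred1.
- move=> /asboolP Ex /asboolP Ey; apply/asboolP=> S ES FS.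
  by rewrite rpredB ?Ex ?Ey.
- move=> /asboolP Ex /asboolP Ey; apply/asboolP=> S ES FS.
  by rewrite rpred_div ?Ex ?Ey.
Qed.

HB.instance Definition _ k s :=
  GRing.isDivringClosed.Build C (adjoin k s) (adjoin_closed k s).

Lemma adjoin_base k s : {subset k <= adjoin k s}.
Proof. by move=> x kx; apply/asboolP=> S kS _; apply: kS. Qed.

Lemma adjoin_gen k s : {subset s <= adjoin k s}.
Proof. by move=> x sx; apply/asboolP=> S _; apply. Qed.

Lemma adjoin_min k s E :
  {subset k <= E} -> {subset s <= E} -> {subset adjoin k s <= E}.
Proof. by move=> kE sE x /asboolP; apply. Qed.

Lemma compositum_subl k E : {subset k <= compositum k E}.
Proof. by move=> x kx; apply/asboolP=> S kS _; apply: kS. Qed.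

Lemma compositum_subr k E : {subset E <= compositum k E}.
Proof. by move=> x kx; apply/asboolP=> S _; apply. Qed.

Lemma compositum_min k E (S : divringClosed C) :
  {subset k <= S} -> {subset E <= S} -> {subset compositum k E <= S}.
Proof. by move=> kS ES x /asboolP; apply. Qed.

Lemma horner_in k E r x :
  {subset k <= E} -> r \is a polyOver k -> x \in E -> r.[x] \in E.
Proof. by move=> kE kr xE; apply: rpred_horner xE; apply: polyOver_sub kr. Qed.

(** Polynomial expressions in [x] already form a field, because the inverse of an algebraic element
    is a polynomial in it. *)
Lemma adjoin_polyP k x y : (forall z, algebraic_over k z) ->
  y \in adjoin k [:: x] <-> exists2 r, r \is a polyOver k & y = r.[x].
Proof.
move=> alg; split=> [|[r kr ->]]; last first.
  apply: horner_in kr _; first exact: adjoin_base.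
  by apply: adjoin_gen; rewrite inE.
pose S : {pred C} :=
  [pred y | `[< exists2 r, r \is a polyOver k & y = r.[x] >]].
have S_closed : divring_closed S.
  split=> [|u v|u v]; rewrite ?inE.
  - by apply/asboolP; exists 1; rewrite ?rpred1 ?hornerE.
  - move=> /asboolP[p kp ->] /asboolP[q kq ->]; apply/asboolP.
    by exists (p - q); rewrite ?rpredB ?hornerE.
  - move=> /asboolP[p kp ->] /asboolP[q kq ->]; apply/asboolP.
    have [r kr ->] := horner_inv (alg q.[x]).
    exists (p * (r \Po q)); first by rewrite rpredM ?polyOver_comp.
    by rewrite hornerM horner_comp.
pose S' : divringClosed C :=
  HB.pack S (GRing.isDivringClosed.Build C S S_closed).
move=> /(@adjoin_min _ _ S') h.
have /asboolP : y \in S' by apply: h => [u ku|u]; [|rewrite inE => /eqP->];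
  apply/asboolP; [exists u%:P|exists 'X];
    rewrite ?polyOverC ?polyOverX ?hornerE.
by [].
Qed.

End PolyOverSubfield.

(** * Homomorphisms from subfields into the ambient field *)

Section Homomorphisms.
Variable C : fieldType.
Implicit Types (k E : divringClosed C) (p q r : {poly C}) (x y : C).

Lemma hom_horner k E (f : {rmorphism subfield_type E -> C}) :
  {subset k <= E} -> (forall z, val z \in k -> f z = val z) ->
  forall r z w, r \is a polyOver k -> val z = r.[val w] -> f z = r.[f w].
Proof.
move=> kE fk r z w kr; have /polyOver_subfieldP[r' Dr] := polyOver_sub kE kr.
rewrite {1}Dr horner_map => /val_inj->; rewrite -horner_map; congr _.[_].
apply/polyP=> i; rewrite Dr !coef_map /= fk //.
by have /polyOverP/(_ i) := kr; rewrite Dr coef_map.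
Qed.

(** The map sends [r.[x]] to [r.[y]]: polynomials with the same value at [x] differ by a multiple of
    [p], which vanishes at [y]. Asking only that [E] lie in [k(x)] lets [E] be a compositum as
    well. *)
Lemma simple_hom_exists k E x y p :
  (forall z, algebraic_over k z) -> {subset E <= adjoin k [:: x]} ->
  min_poly k x p -> root p y ->
  exists f : {rmorphism subfield_type E -> C},
    forall z r, r \is a polyOver k -> val z = r.[x] -> f z = r.[y].
Proof.
move=> alg Ex minp py.
have ch (z : subfield_type E) : {r | r \is a polyOver k & val z = r.[x]}.
  by apply/cid2/(adjoin_polyP _ _ alg)/Ex/valP.
pose f z := (s2val (ch z)).[y].
have fE z r : r \is a polyOver k -> val z = r.[x] -> f z = r.[y].
  rewrite /f; case: (ch z) => r' /= kr' -> kr => /eqP;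
    rewrite -subr_eq0 -hornerN -hornerD.
  move=> /(min_poly_dvd minp (rpredB kr' kr)) /dvdpP[s Ds]; apply/eqP;
    rewrite -subr_eq0 -hornerN -hornerD Ds.
  by rewrite hornerM (rootP py) mulr0.
have fB : zmod_morphism f.
  move=> u v; case: (ch u) (ch v) => [r kr ru] [s ks sv].
  rewrite (fE u r) // (fE v s) // (fE _ (r - s)) ?rpredB ?hornerE //.
  by rewrite rmorphB /= ru sv.
have fM : monoid_morphism f.
  split=> [|u v]; first by rewrite (fE 1 1) ?rpred1 ?hornerE ?rmorph1.
  case: (ch u) (ch v) => [r kr ru] [s ks sv].
  rewrite (fE u r) // (fE v s) // (fE _ (r * s)) ?rpredM ?hornerE //.
  by rewrite rmorphM /= ru sv.
pose g : {rmorphism subfield_type E -> C} := HB.pack f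
  (GRing.isZmodMorphism.Build _ _ f fB) (GRing.isMonoidMorphism.Build _ _ f fM).
by exists g.
Qed.

(* The elements of [E] that [f] maps into [S] form a subfield. *)
Lemma hom_adjoin k E s (f : {rmorphism subfield_type E -> C})
    (S : divringClosed C) :
  {subset E <= adjoin k s} ->
  (forall z, val z \in k -> f z \in S) ->
  (forall z, val z \in s -> f z \in S) ->
  {subset k <= E} -> {subset s <= E} ->
  forall z, f z \in S.
Proof.
move=> Es fk fs kE sE z.
pose P : {pred C} :=
  [pred u | `[< exists2 w : subfield_type E, val w = u & f w \in S >]].
have P_closed : divring_closed P.
  split=> [|u v|u v]; rewrite ?inE.
  - by apply/asboolP; exists 1; rewrite ?rmorph1 ?rpred1.
  - move=> /asboolP[a <- Sa] /asboolP[b <- Sb]; apply/asboolP.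
    by exists (a - b); rewrite rmorphB // rpredB.
  - move=> /asboolP[a <- Sa] /asboolP[b <- Sb]; apply/asboolP.
    by exists (a / b); rewrite fmorph_div // rpred_div.
pose P' : divringClosed C :=
  HB.pack P (GRing.isDivringClosed.Build C P P_closed).
have /asboolP[w /val_inj-> //] : val z \in P'.
apply: (@adjoin_min _ k s); last exact/Es/valP.
  by move=> u ku; apply/asboolP; exists (Sub u (kE u ku)); rewrite ?fk ?SubK.
by move=> u ku; apply/asboolP; exists (Sub u (sE u ku)); rewrite ?fs ?SubK.
Qed.

End Homomorphisms.

(** * Normality, separability and primitive elements in characteristic 0 *)

Definition normal_over (C : fieldType) (k E : divringClosed C) :=
  forall x, x \in E -> forall p, min_poly k x p -> forall y, root p y ->
    y \in E.

Section ClosedField.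
Variable C : closedFieldType.
Hypothesis char0 : [pchar C] =i pred0.
Implicit Types (k E : divringClosed C) (p q r : {poly C}) (x y : C).

(** A common root of [p] and its derivative would have [p] as its minimal polynomial, while the
    derivative is nonzero and smaller. *)
Lemma min_poly_separable k x p :
  (forall z, algebraic_over k z) -> min_poly k x p -> separable_poly p.
Proof.
move=> alg minp; rewrite unlock; apply/Pdiv.ClosedField.coprimepP=> y py.
have [kp pm _ pmin] := min_poly_conj (alg y) minp py.
have kp' : p^`() \is a polyOver k by rewrite polyOver_deriv.
have p1 := root_size_gt1 (monic_neq0 pm) py.
have p'0 : p^`() != 0.
  (* This coefficient of the derivative is [(size p).-1] times the leading coefficient [1], nonzero
     in characteristic 0. *)
  apply/eqP=> /(congr1 (fun q : {poly C} => q`_(size p).-2)).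
  move: (monicP pm) p1; rewrite lead_coefE coef_deriv coef0.
  case: (size p) => [|[|n]] //= -> _ /eqP.
  by rewrite ((pcharf0P C).1 char0).
apply/negP=> p'y; have := pmin _ kp' p'0 p'y.
by rewrite leqNgt lt_size_deriv ?monic_neq0.
Qed.

(** Characteristic 0 gives separability and the algebraically closed ambient field gives splitting;
    only the location of the conjugates remains. *)
Lemma galois_extP k E : (forall z, algebraic_over k z) ->
  galois_ext k E <-> {subset k <= E} /\ normal_over k E.
Proof.
move=> alg; split=> [[kE gal]|[kE nor]]; split=> // x Ex.
  move=> p minp y; have [_ /(_ p minp)[_ [rs [rsE ->]]]] := gal x Ex.
  by rewrite root_prod_XsubC; apply: rsE.
split=> // p minp; split; first exact: min_poly_separable minp.
have [rs Dp] := closed_field_poly_normal p; exists rs.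
have [_ pm _ _] := minp; rewrite (monicP pm) scale1r in Dp; split=> // y ry.
by apply: nor Ex _ minp _ _; rewrite Dp root_prod_XsubC.
Qed.

Lemma primitive_element k s : (forall z, algebraic_over k z) ->
  exists2 z, z \in adjoin k s & {subset s <= adjoin k [:: z]}.
Proof.
move=> alg; elim: s => [|x s [y ys sy]].
  by exists 0; rewrite ?rpred0.
have [p [/polyOver_subfieldP[p' ->] p0 px]] := alg x.
have [q [/polyOver_subfieldP[q' ->] q0 qy]] := alg y.
rewrite !map_poly_eq0 in p0 q0.
have ch0 : [pchar subfield_type k] =i pred0.
  by move=> n; rewrite -(fmorph_pchar (val : subfield_type k -> C)) char0.
(* The new element [x] and the generator [y] obtained for the tail are replaced by the single
   [y *+ n - x]. *)
have [n /=] := pchar0_PET p0 px q0 qy ch0;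
  set z := y *+ n - x => -[[r rz] [r' rz']].
have zx : x \in adjoin k [:: z].
  by apply/adjoin_polyP=> //; exists (map_poly val r) => //;
    apply/polyOver_subfieldP; exists r.
have zy : y \in adjoin k [:: z].
  by apply/adjoin_polyP=> //; exists (map_poly val r') => //;
    apply/polyOver_subfieldP; exists r'.
exists z.
  rewrite rpredB ?rpredMn //; last by apply: adjoin_gen; rewrite inE eqxx.
  apply: adjoin_min ys; first exact: adjoin_base.
  by move=> u su; apply: adjoin_gen; rewrite inE su orbT.
move=> u; rewrite inE => /predU1P[-> //|/sy].
apply: adjoin_min; first exact: adjoin_base.
by move=> v; rewrite inE => /eqP->.
Qed.

(* If no conjugate of [g] solved [r = y], then [q] and [r - y] would be
   coprime, and so would [q] and [r - x] over [k(x)], which share the root [g]. *)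
Lemma conj_lift k g x y p q r : (forall z, algebraic_over k z) ->
  r \is a polyOver k -> x = r.[g] -> min_poly k x p -> root p y ->
  q \is a polyOver k -> root q g -> exists2 g', root q g' & y = r.[g'].
Proof.
move=> alg kr Dx minp py kq qg; apply: contrapT => no.
have cop : coprimep q (r - y%:P).
  apply/Pdiv.ClosedField.coprimepP=> g' qg';
    rewrite hornerD hornerN hornerC subr_eq0.
  by apply/eqP=> ry; apply: no; exists g'.
pose E : divringClosed C := adjoin k [:: x];
  have kE : {subset k <= E} := @adjoin_base _ k _.
have Ex : x \in E by apply: adjoin_gen; rewrite inE.
have [f fP] := simple_hom_exists alg (fun z (h : z \in E) => h) minp py.
have fk z : val z \in k -> f z = val z.
  by move=> kz; rewrite (fP z (val z)%:P) ?polyOverC ?hornerC.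
have mapf u u' : u \is a polyOver k -> u = map_poly val u' -> map_poly f u' = u.
  move=> /polyOverP ku Du; apply/polyP=> i; rewrite Du !coef_map /= fk //.
  by have := ku i; rewrite Du coef_map.
have /polyOver_subfieldP[q' Dq] := polyOver_sub kE kq.
have /polyOver_subfieldP[r' Dr] := polyOver_sub kE kr.
pose x' : subfield_type E := Sub x Ex.
have Dy : f x' = y by rewrite (fP x' 'X) ?polyOverX ?hornerX //= SubK.
(* Field homomorphisms preserve and reflect coprimality: [q] and [r - y] are the images under [f] of
   [q'] and [r' - x'], whose images under [val] are [q] and [r - x]. *)
move: cop; rewrite -(mapf _ _ kq Dq) -(mapf _ _ kr Dr) -Dy -map_polyC -rmorphB.
rewrite coprimep_map -(coprimep_map val) rmorphB /=.
rewrite (map_polyC (val : subfield_type E -> C)) -Dq -Dr => /coprimep_root.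
by move=> /(_ _ qg); rewrite hornerD hornerN hornerC -Dx subrr eqxx.
Qed.

(** A conjugate of [x = r.[g]] is [r.[g']] for a conjugate [g'] of the primitive element [g]. The
    homomorphism taking [g] to [g'] sends the elements of [s] to conjugates, hence maps [E] into
    itself, and it sends [x] to [r.[g']]. *)
Lemma normal_adjoin k E s : (forall z, algebraic_over k z) ->
  {subset k <= E} -> {subset s <= E} -> {subset E <= adjoin k s} ->
  (forall x, x \in s -> forall p, min_poly k x p -> forall y, root p y ->
    y \in E) ->
  normal_over k E.
Proof.
move=> alg kE sE Es conjs x Ex p minp y py.
have [g gs sg] := primitive_element s alg.
have Eg : {subset E <= adjoin k [:: g]}.
  move=> u /Es; apply: adjoin_min sg _; exact: adjoin_base.
have [r kr Dx] := (adjoin_polyP g x alg).1 (Eg _ Ex).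
have [q minq] := min_poly_exists (alg g); have [kq _ qg _] := minq.
have [g' qg' ->] := conj_lift alg kr Dx minp py kq qg.
have [f fP] := simple_hom_exists alg Eg minq qg'.
have fk z : val z \in k -> f z = val z.
  by move=> kz; rewrite (fP z (val z)%:P) ?polyOverC ?hornerC.
rewrite -(fP (Sub x Ex) r) ?SubK //.
apply: (hom_adjoin Es) => // z => [kz|sz]; first by rewrite fk ?kE.
have [u minu] := min_poly_exists (alg (val z)); have [ku _ uz _] := minu.
apply: conjs sz _ minu _ _; apply/rootP.
have := hom_horner kE fk (z := 0) ku; move=> <-; rewrite ?rmorph0 //.
by rewrite (rootP uz).
Qed.

End ClosedField.

(** * Linear disjointness and its effect on minimal polynomials and simple extensions *)

Definition linearly_disjoint (C : fieldType) (k L M : divringClosed C) :=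
  forall n (a b : nat -> C), (forall i, a i \in L) -> (forall i, b i \in M) ->
    \sum_(i < n) a i * b i = 0 -> (exists2 i, (i < n)%N & a i != 0) ->
  exists c : nat -> C, [/\ forall i, c i \in k, \sum_(i < n) c i * b i = 0 &
    exists2 i, (i < n)%N & c i != 0].

Section LinearDisjointness.
Variable C : fieldType.
Implicit Types (k E L M : divringClosed C) (p q r : {poly C}) (x y : C).

Lemma min_poly_small k x p r : min_poly k x p -> r \is a polyOver k ->
  (size r < size p)%N -> r.[x] = 0 -> r = 0.
Proof.
move=> [_ _ _ pmin] kr rp rx; apply: contraTeq rp => r0.
by rewrite -leqNgt pmin //; apply/rootP.
Qed.

Lemma adjoin_small k x y p : (forall z, algebraic_over k z) ->
  min_poly k x p -> y \in adjoin k [:: x] ->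
  exists r, [/\ r \is a polyOver k, (size r < size p)%N & y = r.[x]].
Proof.
move=> alg [kp pm px _] /(adjoin_polyP _ _ alg)[r kr ->].
exists (r %% p); split; [exact: modp_over | by rewrite ltn_modp monic_neq0 |].
by rewrite [in LHS](divp_eq r p) hornerD hornerM (rootP px) mulr0 add0r.
Qed.

(** A polynomial [w] over [L] killing [x] is a relation among powers of [x]; it descends to one over
    [k] of the same length, so [size p <= size w]. *)
Lemma linearly_disjoint_min_poly k L M x p :
  {subset k <= L} -> linearly_disjoint k L M -> x \in M ->
  min_poly k x p -> min_poly L x p.
Proof.
move=> kL disj Mx [kp pm px pmin]; split=> // [|w Lw w0 /rootP wx].
  exact: polyOver_sub kp.
have [||||c [kc cx [i iw ci0]]] :=
  disj (size w) (fun i => w`_i) (fun i => x ^+ i).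
- by move=> i; apply/polyOverP.
- by move=> i; apply: rpredX.
- by rewrite -horner_coef.
- exists (size w).-1; last by rewrite -lead_coefE lead_coef_eq0.
  by rewrite prednK // size_poly_gt0.
apply: leq_trans (size_poly (size w) c); apply: pmin.
- by apply: polyOver_poly => j _.
- by apply/eqP=> /(congr1 (fun v : {poly C} => v`_i)) /eqP;
  rewrite coef_poly iw coef0 (negPf ci0).
- by apply/rootP; rewrite horner_poly.
Qed.

Lemma linearly_disjoint_adjoin k L M x y : (forall z, algebraic_over k z) ->
  {subset k <= L} -> linearly_disjoint k L M -> x \in M -> y \in M ->
  y \in adjoin L [:: x] -> y \in adjoin k [:: x].
Proof.
move=> alg kL disj Mx My Ly.
have algL z := algebraic_over_sub kL (alg z).
have [p minp] := min_poly_exists (alg x).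
have [r [Lr rp Dy]] :=
  adjoin_small algL (linearly_disjoint_min_poly kL disj Mx minp) Ly.
case Dn : (size p) rp => [|n] // rn; rewrite ltnS in rn.
(* Index [0] carries [y] with coefficient [-1], and index [j.+1] carries [x ^+ j]. The relation
   obtained over [k] is to be solved for [y]. *)
have [||||c [kc]] := disj n.+1 (fun i => if i is j.+1 then r`_j else -1)
  (fun i => if i is j.+1 then x ^+ j else y).
- by case=> [|j]; rewrite ?rpredN1 //; apply/polyOverP.
- by case=> [|j] //; apply: rpredX.
- by rewrite big_ord_recl /= mulN1r -horner_coef_wide // -Dy addNr.
- by exists 0; rewrite ?oppr_eq0 ?oner_eq0.
rewrite big_ord_recl /=; pose w := \poly_(i < n) c i.+1.
have kw : w \is a polyOver k by apply: polyOver_poly => j _.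
have -> : \sum_(i < n) c (bump 0 i) * x ^+ i = w.[x] by rewrite horner_poly.
(* If [y] dropped out, [w] would kill [x] and be smaller than [p], so every coefficient would
   vanish. *)
have [c0|c0] := eqVneq (c 0) 0.
  rewrite c0 mul0r add0r => wx [i i_n ci0].
  have w0 : w = 0 by apply: min_poly_small minp kw _ wx;
    rewrite Dn ltnS size_poly.
  case: i => [|i] in i_n ci0; first by rewrite c0 eqxx in ci0.
  have := congr1 (fun v : {poly C} => v`_i) w0; rewrite coef_poly coef0.
  by rewrite -ltnS i_n => /eqP; rewrite (negPf ci0).
move=> /eqP; rewrite addr_eq0 => /eqP cy _.
have -> : y = (c 0)^-1 * - w.[x] by rewrite -cy mulKf.
apply/(adjoin_polyP _ _ alg); exists (- (c 0)^-1 *: w).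
  by rewrite polyOverZ // rpredN rpredV.
by rewrite hornerZ mulNr mulrN.
Qed.

End LinearDisjointness.

(** * Linear disjointness over the intersection when one field is normal *)

Section LinearDisjointnessOfNormal.
Variable C : closedFieldType.
Hypothesis char0 : [pchar C] =i pred0.
Implicit Types (k E L M : divringClosed C) (p q r : {poly C}) (x y : C).

(* The roots of the minimal polynomial over [A] are conjugates over [K], hence
   lie in [N]; so its coefficients lie in [N] and in [A]. *)
Lemma min_poly_meet (K k N A : divringClosed C) x p :
  (forall z, algebraic_over K z) ->
  {subset K <= A} -> normal_over K N ->
  {subset k <= A} -> (forall z, z \in N -> z \in A -> z \in k) -> x \in N ->
  min_poly k x p -> min_poly A x p.
Proof.
move=> alg KA norN kA NAk Nx [kp pm px pmin].
have [q minq] := min_poly_exists (algebraic_over_sub KA (alg x)).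
have [Aq qm qx qmin] := minq; have [u minu] := min_poly_exists (alg x).
have [Ku _ ux _] := minu; have qu := min_poly_dvd minq (polyOver_sub KA Ku) ux.
have kq : q \is a polyOver k.
  have [rs Dq] := closed_field_poly_normal q; rewrite (monicP qm) scale1r in Dq.
  have Nq : q \is a polyOver N.
    rewrite Dq big_seq rpred_prod // => y rsy; rewrite polyOverXsubC.
    apply: norN Nx _ minu _ _; apply: root_dvdp qu _.
    by rewrite Dq root_prod_XsubC.
  by apply/polyOverP=> i; apply: NAk; apply/polyOverP.
split=> // [|w Aw w0 wx]; first exact: polyOver_sub kp.
apply: leq_trans (qmin _ Aw w0 wx).
by apply: pmin => //; apply: monic_neq0.
Qed.

Lemma primitive_element_of k M n (b : nat -> C) :
  (forall z, algebraic_over k z) ->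
  {subset k <= M} -> (forall i, b i \in M) ->
  exists2 x, x \in M & forall i, (i < n)%N -> b i \in adjoin k [:: x].
Proof.
move=> alg kM Mb.
have [x xb bx] := primitive_element char0 [seq b i | i <- iota 0 n] alg.
exists x => [|i i_n]; last by apply/bx/map_f; rewrite mem_iota.
by apply: adjoin_min xb => // y /mapP[i _ ->].
Qed.

(** With [a i = (r i).[x]] for a primitive element [x], the sum of the [b i *: r i] kills [x] and is
    smaller than [p], still minimal over [M]. Hence it is zero, and each of its coefficients is a
    relation over [k]. *)
Lemma linearly_disjoint_left k L M : (forall z, algebraic_over k z) ->
  {subset k <= L} -> {subset k <= M} ->
  (forall x p, x \in L -> min_poly k x p -> min_poly M x p) ->
  linearly_disjoint k L M.
Proof.
move=> alg kL kM minLM n a b La Mb ab0 [i0 i0n ai0].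
have [x Lx ax] := primitive_element_of n alg kL La.
have [p minp] := min_poly_exists (alg x).
have rP i : exists r, (i < n)%N ->
  [/\ r \is a polyOver k, (size r < size p)%N & a i = r.[x]].
  have [i_n|] := ltnP i n; last by exists 0.
  by have [r rP] := adjoin_small alg minp (ax i i_n); exists r.
have [r {}rP] := choice rP.
have w0 : \sum_(i < n) b i *: r i = 0.
  apply: (min_poly_small (minLM _ _ Lx minp)).
  - apply: rpred_sum => i _; rewrite polyOverZ //.
    by apply: polyOver_sub kM _; case: (rP i (ltn_ord i)).
  - have [kp pm _ _] := minp;
    have p0 : (0 < size p)%N by rewrite size_poly_gt0 monic_neq0.
    rewrite -(prednK p0) ltnS; apply: (leq_trans (size_sum _ _ _));
      apply/bigmax_leqP => i _.
    apply: leq_trans (size_scale_leq _ _) _; rewrite -ltnS prednK //.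
    by case: (rP i (ltn_ord i)).
  - rewrite horner_sum -[RHS]ab0; apply: eq_bigr => i _.
    by rewrite hornerZ mulrC; case: (rP i (ltn_ord i)) => _ _ ->.
(* The degree [j] is chosen so that the relation read off there is nontrivial at [i0]. *)
have [j rj0] : exists j, (r i0)`_j != 0.
  apply: contrapT => no; case/eqP: ai0; have [_ _ ->] := rP i0 i0n.
  suff -> : r i0 = 0 by rewrite horner0.
  by apply/polyP=> j; rewrite coef0; apply/eqP; apply: contrapT => /negP ?;
    apply: no; exists j.
(* Beyond [n] nothing is known about [r], yet [c] must stay in [k]; hence the default [0]. *)
exists (fun i => if (i < n)%N then (r i)`_j else 0); split; last by exists i0;
  rewrite ?i0n.
  by move=> i; case: ifP => [/rP[kr _ _]|]; [apply/polyOverP | rewrite rpred0].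
have := congr1 (fun v : {poly C} => v`_j) w0; rewrite coef0 coef_sum => rj.
by rewrite -[RHS]rj; apply: eq_bigr => i _; rewrite ltn_ord coefZ mulrC.
Qed.

(** Now [b i = (r i).[x]], and the sum of the [a i *: r i] vanishes. The coefficient rows of the
    [r i] are thus dependent over [C] and, as field extension preserves rank, over [k]. *)
Lemma linearly_disjoint_right k L M : (forall z, algebraic_over k z) ->
  {subset k <= L} -> {subset k <= M} ->
  (forall x p, x \in M -> min_poly k x p -> min_poly L x p) ->
  linearly_disjoint k L M.
Proof.
move=> alg kL kM minML n a b La Mb ab0 [i0 i0n ai0].
have [x Mx bx] := primitive_element_of n alg kM Mb.
have [p minp] := min_poly_exists (alg x).
have rP i : exists r' : {poly subfield_type k}, (i < n)%N ->
    (size r' < size p)%N /\ b i = (map_poly val r').[x].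
  have [i_n|] := ltnP i n; last by exists 0.
  have [r [/polyOver_subfieldP[r' ->] rp ->]] :=
    adjoin_small alg minp (bx i i_n).
  by exists r' => _; rewrite -(size_map_poly (val : subfield_type k -> C)).
have [r {}rP] := choice rP.
have w0 : \sum_(i < n) a i *: map_poly val (r i) = 0.
  apply: (min_poly_small (minML _ _ Mx minp)).
  - apply: rpred_sum => i _; rewrite polyOverZ //.
    by apply: polyOver_sub kL _; apply/polyOver_subfieldP; exists (r i).
  - have [kp pm _ _] := minp;
    have p0 : (0 < size p)%N by rewrite size_poly_gt0 monic_neq0.
    rewrite -(prednK p0) ltnS; apply: (leq_trans (size_sum _ _ _));
      apply/bigmax_leqP => i _.
    apply: leq_trans (size_scale_leq _ _) _;
      rewrite -ltnS prednK // size_map_poly.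
    by case: (rP i (ltn_ord i)).
  - rewrite horner_sum -[RHS]ab0; apply: eq_bigr => i _.
    by rewrite hornerZ; case: (rP i (ltn_ord i)) => _ ->.
pose A : 'M[subfield_type k]_(n, size p) := \matrix_(i, j) (r i)`_j.
have nfree : ~~ row_free A.
  rewrite -(row_free_map (val : subfield_type k -> C)).
  apply: contra ai0 => Afree;
    have /eqP : (\row_(i < n) a i) *m map_mx val A = 0.
    apply/rowP=> j; rewrite !mxE; have := congr1 (fun v : {poly C} => v`_j) w0.
    rewrite coef0 coef_sum => rj; rewrite -[RHS]rj; apply: eq_bigr => i _.
    by rewrite !mxE coefZ coef_map.
  rewrite mulmx_free_eq0 // => /eqP/rowP/(_ (Ordinal i0n)).
  by rewrite !mxE => /eqP.
have [v vA v0] : exists2 v : 'rV_n, v *m A = 0 & v != 0.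
  apply: contrapT => no; case/negP: nfree; apply: inj_row_free => v vA.
  by apply/eqP; apply: contrapT => /negP v0; apply: no; exists v.
exists (fun i => val (rVpoly v)`_i); split; first by move=> i; apply: valP.
  have -> : \sum_(i < n) val (rVpoly v)`_i * b i =
      (map_poly val (\sum_(i < n) v 0 i *: r i)).[x].
    rewrite rmorph_sum horner_sum; apply: eq_bigr => i _.
    rewrite coef_rVpoly_ord /= (map_polyZ (val : subfield_type k -> C)) hornerZ.
    by case: (rP i (ltn_ord i)) => _ ->.
  suff -> : \sum_(i < n) v 0 i *: r i = 0 by rewrite rmorph0 horner0.
  apply/polyP=> j; rewrite coef0 coef_sum; have [j_p|p_j] := ltnP j (size p).
    have /rowP/(_ (Ordinal j_p)) := vA; rewrite !mxE => vAj.
    by rewrite -[RHS]vAj; apply: eq_bigr => i _; rewrite coefZ !mxE.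
  rewrite big1 // => i _; rewrite coefZ nth_default ?mulr0 //.
  by case: (rP i (ltn_ord i)) => ri _; apply: leq_trans (ltnW ri) p_j.
have [i vi0] : exists i, v 0 i != 0 by apply/rV0Pn.
by exists i => //; rewrite coef_rVpoly_ord fmorph_eq0.
Qed.

Lemma linearly_disjoint_normal (K k L M : divringClosed C) :
  (forall z, algebraic_over K z) ->
  {subset K <= k} -> (forall x, (x \in k) = (x \in L) && (x \in M)) ->
  normal_over K L \/ normal_over K M -> linearly_disjoint k L M.
Proof.
move=> alg Kk Dk nor; have algk z := algebraic_over_sub Kk (alg z).
have kL : {subset k <= L} by move=> x; rewrite Dk => /andP[].
have kM : {subset k <= M} by move=> x; rewrite Dk => /andP[].
have KL x (Kx : x \in K) := kL x (Kk x Kx).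
have KM x (Kx : x \in K) := kM x (Kk x Kx).
case: nor => nor.
  apply: linearly_disjoint_left => // x p;
    apply: (min_poly_meet alg) => // z Lz Mz.
  by rewrite Dk Lz.
apply: linearly_disjoint_right => // x p;
  apply: (min_poly_meet alg) => // z Lz Mz.
by rewrite Dk Lz Mz.
Qed.

Lemma finite_ext_primitive (K F : divringClosed C) :
  (forall z, algebraic_over K z) ->
  finite_ext K F -> exists2 x, x \in F & {subset F <= adjoin K [:: x]}.
Proof.
move=> alg [KF [s [sF Fs]]]; have [x xs sx] := primitive_element char0 s alg.
exists x; first exact: adjoin_min xs.
move=> y /Fs[a [Ka ->]]; apply: rpred_sum => i _; apply: rpredM.
  exact: adjoin_base.
by apply: sx; apply: mem_nth.
Qed.

End LinearDisjointnessOfNormal.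

(** * Embeddings and Galois groups as homomorphisms into the ambient field *)

Lemma bijection_of_relation (T U : Type) (R : T -> U -> Prop) :
  (forall t, exists u, R t u) -> (forall u, exists t, R t u) ->
  (forall t u u', R t u -> R t u' -> u = u') ->
  (forall t t' u, R t u -> R t' u -> t = t') ->
  exists2 f : T -> U, bijective f & forall t, R t (f t).
Proof.
move=> /choice[f fR] /choice[g gR] Ru Rt; exists f => //; exists g => [t|u].
  exact: Rt (gR _) (fR _).
exact: Ru (fR _) (gR _).
Qed.

Section FieldHom.
Variables (C : fieldType) (F E : divringClosed C).
Implicit Type f : {rmorphism subfield_type E -> C}.

Lemma embedding_inj (e e' : embedding F E) : sval e =1 sval e' -> e = e'.
Proof.
case: e e' => [e eP] [e' e'P] /= /funext ee'; rewrite ee' in eP *.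
by rewrite (bool_irrelevance eP e'P).
Qed.

Lemma embedding_hom (e : embedding F E) :
  exists2 f : {rmorphism subfield_type E -> C},
    (f : subfield_type E -> C) = sval e &
    forall z, val z \in F -> f z = val z.
Proof.
case: e => e /= /asboolP[eB eM eF].
pose f : {rmorphism subfield_type E -> C} := HB.pack e
  (GRing.isZmodMorphism.Build _ _ e eB) (GRing.isMonoidMorphism.Build _ _ e eM).
by exists f.
Qed.

Lemma hom_embedding f : (forall z, val z \in F -> f z = val z) ->
  exists e : embedding F E, sval e = f.
Proof.
move=> fF; have fP : `[< [/\ zmod_morphism f, monoid_morphism f &
    forall z : subfield_type E, val z \in F -> f z = val z] >].
  apply/asboolP; split=> //; first exact: raddfB.
  by split; [apply: rmorph1 | apply: rmorphM].
by exists (exist _ (f : _ -> _) fP).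
Qed.

(** Viewing automorphisms as homomorphisms into [C] lets the same extension and restriction lemmas
    serve embeddings and Galois groups. *)
Lemma gal_hom (s : gal F E) :
  exists2 f : {rmorphism subfield_type E -> C},
    forall z, f z = val (gal_fun s z) &
    forall z, val z \in F -> f z = val z.
Proof.
case: s => s sP; have /asboolP[sB sM _ sF] := sP; rewrite /gal_fun /=.
pose g : {rmorphism subfield_type E -> subfield_type E} := HB.pack s
  (GRing.isZmodMorphism.Build _ _ s sB) (GRing.isMonoidMorphism.Build _ _ s sM).
pose f : {rmorphism subfield_type E -> C} := (val : subfield_type E -> C) \o g.
by exists f => // z Fz; rewrite /f /= sF.
Qed.

Lemma hom_gal f : (forall z, val z \in F -> f z = val z) ->
  (forall z, f z \in E) ->
  (forall w : subfield_type E, exists z, f z = val w) ->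
  exists s : gal F E, forall z, val (gal_fun s z) = f z.
Proof.
move=> fF fE /choice[g fg].
pose s z : subfield_type E := Sub (f z) (fE z).
have sP : `[< is_gal F s >].
  apply/asboolP; split.
  - by move=> u v; apply: val_inj; rewrite rmorphB /= raddfB.
  - split=> [|u v]; apply: val_inj; rewrite ?rmorphM /= ?rmorph1 ?rmorphM //.
  - exists g => z; last by apply: val_inj; rewrite /= fg.
    by apply: (fmorph_inj f); rewrite fg.
  - by move=> z Fz; apply: val_inj; rewrite /= fF.
by exists (exist _ s sP).
Qed.

Lemma hom_conj f z p : {subset F <= E} ->
  (forall z, val z \in F -> f z = val z) ->
  p \is a polyOver F -> root p (val z) -> root p (f z).
Proof.
move=> FE fF Fp /rootP pz; apply/rootP.
by rewrite -(hom_horner FE fF (z := 0) Fp) ?rmorph0 // pz.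
Qed.

End FieldHom.

(** * Homomorphisms of [k(x)] over [k] and of [L(x)] over [L], for a common minimal polynomial of
    [x] *)

Section Extension.
Variables (C : fieldType) (k L E E' : divringClosed C) (x : C) (p : {poly C}).
Hypothesis alg : forall z, algebraic_over k z.
Hypotheses (kL : {subset k <= L}) (kE : {subset k <= E}).
Hypotheses (LE' : {subset L <= E'}) (EE' : {subset E <= E'}).
Hypotheses (Ex : x \in E) (Egen : {subset E <= adjoin k [:: x]}).
Hypothesis E'gen : {subset E' <= adjoin L [:: x]}.
Hypotheses (minp : min_poly k x p) (minpL : min_poly L x p).

Let algL z := algebraic_over_sub kL (alg z).
Let xE : subfield_type E := Sub x Ex.
Let xE' : subfield_type E' := Sub x (EE' Ex).

(** [f] sends [x] to a root of [p], and since [p] is also minimal over [L], some homomorphism over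
    [L] sends [x] to that root. *)
Lemma hom_extend (f : {rmorphism subfield_type E -> C}) :
  (forall z, val z \in k -> f z = val z) ->
  exists2 g : {rmorphism subfield_type E' -> C},
    forall z, val z \in L -> g z = val z &
    forall z z', val z' = val z -> g z' = f z.
Proof.
move=> fk; have [kp _ px _] := minp.
have fx := hom_conj (z := xE) kE fk kp px.
have [g gP] := simple_hom_exists algL E'gen minpL fx.
exists g => [z Lz|z z' zz'];
  first by rewrite (gP z (val z)%:P) ?polyOverC ?hornerC.
have [r kr Dz] := (adjoin_polyP _ _ alg).1 (Egen (valP z)).
rewrite (gP z' r) ?zz' ?(polyOver_sub kL) //.
by rewrite (hom_horner kE fk (z := z) (w := xE) kr).
Qed.

Lemma hom_extend_unique (g h : {rmorphism subfield_type E' -> C}) :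
  (forall z, val z \in L -> g z = val z) ->
  (forall z, val z \in L -> h z = val z) ->
  (forall z, val z \in E -> g z = h z) -> g =1 h.
Proof.
move=> gL hL gh z; have [r Lr Dz] := (adjoin_polyP _ _ algL).1 (E'gen (valP z)).
rewrite (hom_horner LE' gL (w := xE') Lr) //.
rewrite (hom_horner LE' hL (w := xE') Lr) //.
by rewrite gh.
Qed.

Definition incl (z : subfield_type E) : subfield_type E' :=
  Sub (val z) (EE' (valP z)).

Lemma hom_restrict (g : {rmorphism subfield_type E' -> C}) :
  (forall z, val z \in L -> g z = val z) ->
  exists2 f : {rmorphism subfield_type E -> C},
    forall z, val z \in k -> f z = val z &
    forall z z', val z' = val z -> g z' = f z.
Proof.
move=> gL.
have iB : zmod_morphism incl by move=> u v; apply: val_inj.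
have iM : monoid_morphism incl by split=> [|u v]; apply: val_inj.
pose i : {rmorphism subfield_type E -> subfield_type E'} := HB.pack incl
  (GRing.isZmodMorphism.Build _ _ incl iB) (GRing.isMonoidMorphism.Build _ _
    incl iM).
pose f : {rmorphism subfield_type E -> C} := g \o i.
exists f => [z kz|z z' zz']; first by rewrite /f /= gL //= kL.
by rewrite /f /=; congr (g _); apply: val_inj; rewrite /= -zz'.
Qed.

Lemma embedding_bijection : exists f : embedding k E ->
  embedding L E', bijective f.
Proof.
(* [R] says that [e'] extends [e]; existence and uniqueness in both directions make it a
   bijection. *)
pose R (e : embedding k E) (e' : embedding L E') :=
  forall z z', val z' = val z -> sval e' z' = sval e z.
have [||||f fbij _] := @bijection_of_relation _ _ R; last by exists f.
- move=> e; have [f fe fk] := embedding_hom e.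
  have [g gL gf] := hom_extend fk; have [e' De'] := hom_embedding gL.
  by exists e' => z z' zz'; rewrite De' -fe; apply: gf.
- move=> e'; have [g ge gL] := embedding_hom e'.
  have [f fk gf] := hom_restrict gL; have [e De] := hom_embedding fk.
  by exists e => z z' zz'; rewrite De -ge; apply: gf.
- move=> e u v; have [g gu gL] := embedding_hom u;
  have [h hv hL] := embedding_hom v.
  move=> Ru Rv; apply: embedding_inj; rewrite -gu -hv.
  apply: hom_extend_unique => // z Ez.
  by rewrite gu hv (Ru (Sub (val z) Ez)) ?(Rv (Sub (val z) Ez)) ?SubK.
- move=> u v e' Ru Rv; apply: embedding_inj => z.
  by rewrite -(Ru z (incl z)) ?(Rv z (incl z)).
Qed.

(** Extension is again the bijection; normality of [E] keeps restrictions inside [E]. *)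
Lemma gal_isomorphic : normal_over k E -> group_isomorphic (gal k E) (gal L E').
Proof.
move=> norE.
have conjE (f : {rmorphism subfield_type E' ->
  C}) z : (forall z, val z \in L -> f z = val z) ->
    val z \in E -> f z \in E.
  move=> fL Ez; have [u minu] := min_poly_exists (alg (val z));
    have [ku _ uz _] := minu.
  apply: norE Ez _ minu _ _; apply: (hom_conj LE' fL) => //.
  exact: polyOver_sub kL ku.
pose R (s : gal k E) (t : gal L E') :=
  forall z z', val z' = val z -> val (gal_fun t z') = val (gal_fun s z).
have Runiq s t t' : R s t -> R s t' -> t = t'.
  move=> Rt Rt'; have [g gt gL] := gal_hom t; have [h ht' hL] := gal_hom t'.
  apply: val_inj; apply/funext => z; apply: val_inj.
  rewrite -[LHS]gt -[RHS]ht'; apply: hom_extend_unique => // {}z Ez.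
  by rewrite gt ht' (Rt (Sub (val z) Ez)) ?(Rt' (Sub (val z) Ez)) ?SubK.
have [||||f fbij fR] := @bijection_of_relation _ _ R.
- move=> s; have [f fs fk] := gal_hom s; have [g gL gf] := hom_extend fk.
  have [||t Dt] := hom_gal gL; last by exists t => z z' zz'; rewrite Dt -fs;
    apply: gf.
  + apply: (hom_adjoin E'gen) => // [z Lz|z|z]; first by rewrite gL ?LE'.
      rewrite inE => /eqP zx; rewrite (gf xE) ?zx ?SubK //.
      by rewrite fs; apply/EE'/valP.
    by rewrite inE => /eqP->; apply: EE'.
  (* Surjectivity: with [w = r.[x]] and [f z = x], the element [r.[val z]] is sent to [w]. *)
  + move=> w; have [r Lr Dw] := (adjoin_polyP _ _ algL).1 (E'gen (valP w)).
    have [z Dz] : exists z, f z = x.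
      have [t [_ ts]] := is_galV s; exists (gal_fun t xE).
      by rewrite fs ts.
    have [rE' DrE'] : exists z' : subfield_type E', val z' = r.[val z].
      by have h := horner_in LE' Lr (EE' (valP z)); exists (Sub r.[val z] h).
    exists rE'; rewrite (hom_horner LE' gL (w := incl z) Lr) //.
    by rewrite (gf z) // Dz Dw.
- move=> t; have [g gt gL] := gal_hom t; have [f fk gf] := hom_restrict gL.
  have [||s Ds] := hom_gal fk; last by exists s => z z' zz'; rewrite Ds -gt;
    apply: gf.
  + by move=> z; rewrite -(gf z (incl z)) //;
    exact: (conjE g (incl z) gL (valP z)).
  (* The inverse of [t] also maps [E] into [E], which puts the preimage of [w] in [E]. *)
  + move=> w; have [t' [_ tt']] := is_galV t; have [h ht' hL] := gal_hom t'.
    have hE := conjE h (incl w) hL (valP w).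
    exists (Sub (h (incl w)) hE).
    by rewrite -(gf _ (gal_fun t' (incl w))) ?gt ?tt' ?SubK.
- exact: Runiq.
- move=> u v t Ru Rv; apply: val_inj; apply/funext => z; apply: val_inj.
  by rewrite -[LHS](Ru z (incl z)) // -[RHS](Rv z (incl z)).
(* The product of the extensions extends the product, and extensions are unique. *)
have fM : {morph f : s t / (s * t)%g >-> (s * t)%g}.
  move=> s t; apply: (Runiq (s * t)%g) => // z z' zz'.
  by apply: (fR s); apply: (fR t).
pose g : {multiplicative gal k E -> gal L E'} :=
  HB.pack f (isMultiplicative.Build _ _ f fM).
by exists g.
Qed.

End Extension.

(** * Composita of normal extensions, and descent from [L] to [L0] *)

Lemma compositum_adjoin (C : fieldType) (K k F : divringClosed C) x :
  {subset K <= k} -> {subset F <= adjoin K [:: x]} ->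
  {subset compositum k F <= adjoin k [:: x]}.
Proof.
move=> Kk Fx; apply: compositum_min => [|y /Fx]; first exact: adjoin_base.
by apply: adjoin_min => z; [move/Kk; apply: adjoin_base | apply: adjoin_gen].
Qed.

(** The minimal polynomial over [k] divides the one over [K], so conjugates over [k] are conjugates
    over [K]. *)
Lemma normal_conj (C : fieldType) (K k F : divringClosed C) x y q :
  (forall z, algebraic_over K z) -> {subset K <= k} -> normal_over K F ->
  x \in F -> min_poly k x q -> root q y -> y \in F.
Proof.
move=> alg Kk norF Fx minq; have [u minu] := min_poly_exists (alg x).
have [Ku _ ux _] := minu.
by move=> /(root_dvdp (min_poly_dvd minq (polyOver_sub Kk Ku) ux));
  apply: norF minu _.
Qed.

Lemma normal_compositum (C : closedFieldType) (K F1 F2 : divringClosed C) :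
  [pchar C] =i pred0 -> (forall z, algebraic_over K z) ->
  finite_ext K F1 -> finite_ext K F2 -> normal_over K F1 -> normal_over K F2 ->
  normal_over K (compositum F1 F2).
Proof.
move=> char0 alg fin1 fin2 nor1 nor2.
have sub1 := @compositum_subl _ F1 F2; have sub2 := @compositum_subr _ F1 F2.
have [x1 F1x1 F1gen] := finite_ext_primitive char0 alg fin1.
have [x2 F2x2 F2gen] := finite_ext_primitive char0 alg fin2.
apply: (normal_adjoin char0 (s := [:: x1; x2]) alg).
- by move=> x Kx; apply/sub1/fin1.1.
- by move=> x; rewrite !inE => /orP[]/eqP->; [apply: sub1 | apply: sub2].
- apply: compositum_min => x; [move/F1gen | move/F2gen];
    apply: adjoin_min; try exact: adjoin_base;
    by move=> y; rewrite inE => /eqP->; apply: adjoin_gen;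
      rewrite !inE eqxx ?orbT.
- move=> x; rewrite !inE => /orP[]/eqP-> p minp y py.
    by apply: sub1; apply: nor1 minp _ py.
  by apply: sub2; apply: nor2 minp _ py.
Qed.

(** In case (ii) [L0F] need not be Galois over [L0], so the Galois groups are first rendered by
    embeddings; the last clause recovers the groups where the extension is Galois. *)
Theorem theorem3p10
  (C : closedFieldType) (char0 : [pchar C] =i pred0)
  (K F1 F2 L : divringClosed C)
  (K_algebraic : forall x, x \in K -> algebraicOver (@ratr C) x)
  (C_closure_of_K : forall x : C, algebraic_over K x)
  (F1_finite : finite_ext K F1) (F2_finite : finite_ext K F2)
  (F12_entangleable : entangleable_by K F1 F2 L)
  (i_or_ii : (galois_ext K F1 /\ galois_ext K F2) \/ galois_ext K L) :
  let L0 : divringClosed C := capf L (compositum F1 F2) in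
  entangleable_by K F1 F2 L0 /\
  forall F : divringClosed C, F = F1 \/ F = F2 ->
    let L0F : divringClosed C := compositum L0 F in
    let LF : divringClosed C := compositum L F in
    (exists f : embedding L0 L0F -> embedding L LF, bijective f) /\
    ((galois_ext K F1 /\ galois_ext K F2) \/ galois_ext L0 L0F ->
       [/\ galois_ext L0 L0F, galois_ext L LF &
           group_isomorphic (gal L0 L0F) (gal L LF)]).
Proof.
move=> L0; pose M : divringClosed C := compositum F1 F2.
have alg (k : divringClosed C) (Kk : {subset K <= k}) z :=
  algebraic_over_sub Kk (C_closure_of_K z).
have [KL DLF _ LFnL] := F12_entangleable.
have L0L : {subset L0 <= L} by move=> x /andP[].
have L0M : {subset L0 <= M} by move=> x /andP[].
have F1M : {subset F1 <= M} := @compositum_subl _ F1 F2.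
have F2M : {subset F2 <= M} := @compositum_subr _ F1 F2.
have KL0 : {subset K <= L0}.
  by move=> x Kx; rewrite inE /= KL //; apply: F1M; apply: F1_finite.1.
have algK := C_closure_of_K; have algL0 := alg _ KL0; have algL := alg _ KL.
have disj : linearly_disjoint L0 L M.
  apply: (linearly_disjoint_normal char0 algK KL0) => //.
  case: i_or_ii => [[/(galois_extP char0 _ algK)[_ n1] /(galois_extP char0 _
    algK)[_ n2]]|].
    by right; apply: normal_compositum.
  by move=> /(galois_extP char0 _ algK)[_]; left.
(* An element of [L0 F] lies in [M] and in [L(x)], where [x] generates [F'], hence in [L0(x)] by
   linear disjointness. *)
have meetLF (F F' : divringClosed C) : finite_ext K F' ->
    {subset F <= M} -> {subset F' <= M} ->
    {subset compositum L F <= compositum L F'} ->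
    {subset compositum L0 F <= compositum L0 F'}.
  move=> finF' FM F'M LFF' y L0Fy.
  have [x F'x F'gen] := finite_ext_primitive char0 algK finF'.
  have My : y \in M by apply: compositum_min L0Fy.
  have LFy : y \in compositum L F.
    apply: compositum_min L0Fy; last exact: compositum_subr.
    by move=> z /L0L; apply: compositum_subl.
  have Ly := compositum_adjoin KL F'gen (LFF' _ LFy).
  have := linearly_disjoint_adjoin algL0 L0L disj (F'M _ F'x) My Ly.
  apply: adjoin_min; first exact: compositum_subl.
  by move=> z; rewrite inE => /eqP->; apply: compositum_subr.
split.
  split=> //; last first.
  (* If [L0 F1] were contained in [L0], then [F1], and with it [L F1], would lie in [L]. *)
  - move=> L0FL0; apply: LFnL; apply: compositum_min => // x F1x.
    by apply/L0L/L0FL0/compositum_subr.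
  - exact: compositum_subl.
  - move=> x; apply/idP/idP; apply: meetLF => // y; by rewrite DLF.
move=> F DF L0F LF.
have finF : finite_ext K F by case: DF => ->.
have FM : {subset F <= M} by case: DF => ->.
have [x Fx Fgen] := finite_ext_primitive char0 algK finF.
have [p minp] := min_poly_exists (algL0 x).
have minpL := linearly_disjoint_min_poly L0L disj (FM _ Fx) minp.
have L0L0F : {subset L0 <= L0F} := @compositum_subl _ L0 F.
have LLF : {subset L <= LF} := @compositum_subl _ L F.
have L0FLF : {subset L0F <= LF}.
  apply: compositum_min; last exact: compositum_subr.
  by move=> z /L0L; apply: LLF.
have L0Fx : x \in L0F by apply: compositum_subr.
have L0Fgen : {subset L0F <= adjoin L0 [:: x]} := compositum_adjoin KL0 Fgen.
have LFgen : {subset LF <= adjoin L [:: x]} := compositum_adjoin KL Fgen.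
split; first exact: (embedding_bijection algL0 L0L L0L0F LLF L0FLF L0Fx L0Fgen
  LFgen minp minpL).
move=> gal; have norL0 : normal_over L0 L0F.
  case: gal => [|/(galois_extP char0 _ algL0)[] //].
  move=> [/(galois_extP char0 _ algK)[_ n1] /(galois_extP char0 _ algK)[_ n2]].
  have norF : normal_over K F by case: DF => ->.
  apply: (normal_adjoin char0 algL0 L0L0F _ L0Fgen) => y;
    rewrite inE => /eqP-> //.
  move=> q minq z qz; apply: compositum_subr.
  exact: normal_conj algK KL0 norF Fx minq qz.
(* A conjugate of [x] over [L] is one over [L0], so it stays in [L0F]. *)
have norL : normal_over L LF.
  apply: (normal_adjoin char0 algL LLF _ LFgen) => y; rewrite inE => /eqP->.
    exact: L0FLF.
  by move=> q minq z qz; apply/L0FLF/(normal_conj algL0 L0L norL0 L0Fx minq qz).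
split; [exact/galois_extP | exact/galois_extP |].
exact: (gal_isomorphic algL0 L0L L0L0F LLF L0FLF L0Fx L0Fgen LFgen minp minpL).
Qed.
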